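(* \textsc{Multipacking} can be solved in time $n^{O(d)}$ on digraphs of order $n$ and diameter $d$.
   Context: Digraphs are finite and assumed weakly connected. For vertices $u,v$, $d(u,v)$ is the length of a shortest directed path from $u$ to $v$ ($\infty$ if none); $B^+_r(v)=\{u: d(v,u)\le r\}$. The diameter is $\max_{u,v}d(u,v)$ (infinite if not strongly connected). A multipacking of $D$ is a set $S\subseteq V(D)$ such that for every vertex $v$ and every integer $r\ge 1$, $|B^+_r(v)\cap S|\le r$. \textsc{Multipacking}: given $D$ and $k$, decide whether $D$ has a multipacking of size at least $k$. *)

(* Defs.v *)
From mathcomp Require Import all_boot.

Set Implicit Arguments.
Unset Strict Implicit.
Unset Printing Implicit Defensive.

Section Digraph.
Variables (T : finType) (e : rel T).

Definition weakly_connected : Prop :=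
  forall u v, connect (fun x y => e x y || e y x) u v.

Definition has_dpath (u v : T) (l : nat) : bool :=
  [exists p : l.-tuple T, [&& path e u p, last u p == v & uniq (u :: p)]].

(* [None] stands for the infinite distance. A path has no repeated vertex, so
   only the lengths below #|T| need to be searched. *)
Definition dist (u v : T) : option nat :=
  ohead [seq l <- iota 0 #|T| | has_dpath u v l].

Definition out_ball (r : nat) (v : T) : {set T} :=
  [set u | if dist v u is Some l then l <= r else false].

(* [None] stands for the infinite diameter. *)
Definition diameter : option nat :=
  if [forall u, forall v, isSome (dist u v)]
  then Some (\max_(u : T) \max_(v : T) odflt 0 (dist u v))
  else None.

Definition multipacking (S : {set T}) : Prop :=
  forall (v : T) (r : nat), 1 <= r -> #|out_ball r v :&: S| <= r.

Definition has_multipacking (k : nat) : Prop :=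
  exists2 S : {set T}, multipacking S & k <= #|S|.

End Digraph.

(* Random access machine with structured control flow, under the uniform cost
   criterion. A program mentions finitely many registers; the memory is reached
   only by indirect addressing. Addition and truncated subtraction are the only
   arithmetic operations: without unit-cost multiplication, running times are
   polynomially related to those of Turing machines. *)
Record state := State { reg : nat -> nat; mem : nat -> nat }.

Inductive instr :=
| Const (i c : nat)
| Add (i j k : nat)
| Sub (i j k : nat)
| Read (i j : nat)
| Write (i j : nat).

Inductive program :=
| Instr (a : instr)
| Seq (p q : program)
| If (i : nat) (p q : program)
| While (i : nat) (p : program).

Definition set_reg (s : state) (i x : nat) : state :=
  State [eta reg s with i |-> x] (mem s).

Definition set_mem (s : state) (a x : nat) : state :=
  State (reg s) [eta mem s with a |-> x].

Definition step (a : instr) (s : state) : state :=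
  match a with
  | Const i c => set_reg s i c
  | Add i j k => set_reg s i (reg s j + reg s k)
  | Sub i j k => set_reg s i (reg s j - reg s k)
  | Read i j => set_reg s i (mem s (reg s j))
  | Write i j => set_mem s (reg s i) (reg s j)
  end.

(* [exec p s s' t]: started in [s], the program [p] halts in [s'] after exactly
   [t] steps, where every instruction and every test counts as one step. *)
Inductive exec : program -> state -> state -> nat -> Prop :=
| exec_instr a s : exec (Instr a) s (step a s) 1
| exec_seq p q s1 s2 s3 t1 t2 :
    exec p s1 s2 t1 -> exec q s2 s3 t2 -> exec (Seq p q) s1 s3 (t1 + t2)
| exec_if_true i p q s s' t :
    reg s i <> 0 -> exec p s s' t -> exec (If i p q) s s' t.+1
| exec_if_false i p q s s' t :
    reg s i = 0 -> exec q s s' t -> exec (If i p q) s s' t.+1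
| exec_while_true i p s1 s2 s3 t1 t2 :
    reg s1 i <> 0 -> exec p s1 s2 t1 -> exec (While i p) s2 s3 t2 ->
    exec (While i p) s1 s3 (t1 + t2).+1
| exec_while_false i p s :
    reg s i = 0 -> exec (While i p) s s 1.

Lemma exec_det p s s1 s2 t1 t2 :
  exec p s s1 t1 -> exec p s s2 t2 -> s1 = s2 /\ t1 = t2.
Proof.
move=> h1; elim: h1 s2 t2 => {p s s1 t1}.
- by move=> a s s2 t2 h; inversion h.
- move=> p q r1 r2 r3 t1 t2 _ IH1 _ IH2 s2 t h; inversion h; subst.
  by case: (IH1 _ _ H1) => ? ?; subst; case: (IH2 _ _ H5) => -> ->.
- move=> i p q s s' t hi _ IH s2 t2 h; inversion h; subst=> //.
  by case: (IH _ _ H6) => -> ->.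
- move=> i p q s s' t hi _ IH s2 t2 h; inversion h; subst=> //.
  by case: (IH _ _ H6) => -> ->.
- move=> i p r1 r2 r3 t1 t2 hi _ IH1 _ IH2 s2 t h; inversion h; subst=> //.
  by case: (IH1 _ _ H2) => ? ?; subst; case: (IH2 _ _ H6) => -> ->.
- by move=> i p s hi s2 t2 h; inversion h; subst.
Qed.

(* Instance (D, k) for a digraph D on 'I_n: register 0 holds n, register 1 holds
   k, and the memory holds the row-major adjacency matrix from address 0 on;
   everything else is 0. *)
Definition input (n : nat) (e : rel 'I_n) (k : nat) : state :=
  State
    (fun i => match i with 0 => n | 1 => k | _ => 0 end)
    (fun a => [exists u : 'I_n, exists v : 'I_n, (a == u * n + v) && e u v]).

Definition accepting (s : state) : Prop := reg s 0 <> 0.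

(* Main.v *)
Require Import Defs.
From mathcomp Require Import all_boot.
From mathcomp Require Import zify.

Set Implicit Arguments.
Unset Strict Implicit.
Unset Printing Implicit Defensive.

(* If the diameter is d, every ball of radius max(d, 1) is the whole vertex set,
   so a multipacking has at most max(d, 1) vertices. The algorithm looks for
   multipackings of size j = 1, 2, ... and stops at the first j for which there
   is none; subsets of multipackings being multipackings, the answer is then
   k < j, and j <= max(d, 1) + 1.
   A multipacking of size j is a j-tuple meeting the ball condition for the
   radii r < j only (r = 1 forces distinct entries, r >= j is automatic), and a
   vertex is at distance at most r if it is reached by a walk of r steps, each
   of them possibly stationary. Both j-tuples and these walks are coded by the
   base n digits of a number below n^j, so the test for size j is an arithmetic
   formula with quantifiers bounded by L = (n + 1)^(j + 1); it is evaluated by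
   brute force in time polynomial in L. *)

(** * Compiling bounded arithmetic to the machine *)

(** A total correctness triple with a time bound. Since time is only bounded above, the two branches
    of a test can share one estimate, the sum of their bounds. *)
Definition runs (p : program) (s : state) (Q : state -> Prop) (T : nat) : Prop :=
  exists s' t, [/\ exec p s s' t, t <= T & Q s'].

Lemma runs_instr a s (Q : state -> Prop) : Q (step a s) -> runs (Instr a) s Q 1.
Proof. by move=> Qs; exists (step a s), 1; split=> //; exact: exec_instr. Qed.

Lemma runs_seq p q s (Q1 Q2 : state -> Prop) T1 T2 :
  runs p s Q1 T1 -> (forall s1, Q1 s1 -> runs q s1 Q2 T2) ->
  runs (Seq p q) s Q2 (T1 + T2).
Proof.
move=> [s1 [t1 [pP le1 Qs1]]] /(_ _ Qs1) [s2 [t2 [qP le2 Qs2]]].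
by exists s2, (t1 + t2); split; [exact: exec_seq qP|exact: leq_add|].
Qed.

Lemma runs_if i p q s (Q : state -> Prop) T1 T2 :
  (reg s i <> 0 -> runs p s Q T1) -> (reg s i = 0 -> runs q s Q T2) ->
  runs (If i p q) s Q (T1 + T2).+1.
Proof.
move=> hp hq; have [si|/eqP si] := eqVneq (reg s i) 0.
  have [s1 [t1 [qP le1 Qs1]]] := hq si.
  by exists s1, t1.+1; split; [exact: exec_if_false|lia|].
have [s1 [t1 [pP le1 Qs1]]] := hp si.
by exists s1, t1.+1; split; [exact: exec_if_true|lia|].
Qed.

Lemma runs_while_end i p s (Q : state -> Prop) :
  reg s i = 0 -> Q s -> runs (While i p) s Q 1.
Proof. by move=> si Qs; exists s, 1; split=> //; exact: exec_while_false. Qed.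

Lemma runs_while_step i p s (Q1 Q2 : state -> Prop) T1 T2 :
  reg s i <> 0 -> runs p s Q1 T1 ->
  (forall s1, Q1 s1 -> runs (While i p) s1 Q2 T2) ->
  runs (While i p) s Q2 (T1 + T2).+1.
Proof.
move=> si [s1 [t1 [pP le1 Qs1]]] /(_ _ Qs1) [s2 [t2 [qP le2 Qs2]]].
by exists s2, (t1 + t2).+1; split; [exact: exec_while_true qP|lia|].
Qed.

Lemma runs_weaken p s (Q1 Q2 : state -> Prop) T1 T2 :
  runs p s Q1 T1 -> T1 <= T2 -> (forall s1, Q1 s1 -> Q2 s1) -> runs p s Q2 T2.
Proof.
move=> [s1 [t1 [pP le1 Qs1]]] le12 Q12.
by exists s1, t1; split; [|exact: leq_trans le12|exact: Q12].
Qed.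

(* Variables are de Bruijn indices. [Loop e0 e1] starts an accumulator at [e0]
   and updates it by [e1], in which index 0 is the iteration counter and index 1
   the accumulator. All loops have the same number [L] of iterations, so that
   the cost of a term depends on [L] only. *)
Inductive term :=
| Order
| Var (i : nat)
| Cst (c : nat)
| Plus (a b : term)
| Minus (a b : term)
| Fetch (a : term)
| Ite (a b c : term)
| Bind (a b : term)
| Loop (a b : term).

Fixpoint eval (n L : nat) (M : nat -> nat) (e : term) (env : seq nat) : nat :=
  match e with
  | Order => n
  | Var i => nth 0 env i
  | Cst c => c
  | Plus a b => eval n L M a env + eval n L M b env
  | Minus a b => eval n L M a env - eval n L M b env
  | Fetch a => M (eval n L M a env)
  | Ite a b c =>
      if eval n L M a env == 0 then eval n L M c env else eval n L M b env
  | Bind a b => eval n L M b (eval n L M a env :: env)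
  | Loop a b =>
      iteri L (fun i acc => eval n L M b [:: i, acc & env]) (eval n L M a env)
  end.

Definition copy (i j : nat) : program :=
  Seq (Instr (Const i 0)) (Instr (Add i j i)).

(* Register 0 holds the order of the digraph and register 2 the bound [L];
   [compile vars l e] finds the value of variable [i] in register [vars`_i],
   leaves the value of [e] in register [l], and modifies no register below [l]. *)
Fixpoint compile (vars : seq nat) (l : nat) (e : term) : program :=
  match e with
  | Order => copy l 0
  | Var i => if i < size vars then copy l (nth 0 vars i) else Instr (Const l 0)
  | Cst c => Instr (Const l c)
  | Plus a b =>
      Seq (compile vars l a) (Seq (compile vars l.+1 b) (Instr (Add l l l.+1)))
  | Minus a b =>
      Seq (compile vars l a) (Seq (compile vars l.+1 b) (Instr (Defs.Sub l l l.+1)))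
  | Fetch a => Seq (compile vars l a) (Instr (Read l l))
  | Ite a b c =>
      Seq (compile vars l a) (If l (compile vars l b) (compile vars l c))
  | Bind a b =>
      Seq (compile vars l a) (Seq (compile (l :: vars) l.+1 b) (copy l l.+1))
  | Loop a b =>
      Seq (compile vars l a) (Seq (Instr (Const l.+1 0)) (Seq (copy l.+2 2)
        (While l.+2
          (Seq (compile [:: l.+1, l & vars] l.+3 b) (Seq (copy l l.+3)
            (Seq (Instr (Const l.+3 1)) (Seq (Instr (Add l.+1 l.+1 l.+3))
              (Instr (Defs.Sub l.+2 l.+2 l.+3)))))))))
  end.

(** In a [Loop], the 7 covers five instructions after the body, one test and one unit of slack; the
    last 1 is the final test. *)
Fixpoint cost (e : term) (L : nat) : nat :=
  match e with
  | Order | Var _ => 2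
  | Cst _ => 1
  | Plus a b | Minus a b => cost a L + (cost b L + 1)
  | Fetch a => cost a L + 1
  | Ite a b c => cost a L + (cost b L + cost c L).+1
  | Bind a b => cost a L + (cost b L + 2)
  | Loop a b => cost a L + (1 + (2 + (L * (cost b L + 7) + 1)))
  end.

(** The frame condition of compiled terms: they never use [Write], so the adjacency matrix
    survives. *)
Definition agree (l : nat) (s s' : state) : Prop :=
  (forall i, i < l -> reg s' i = reg s i) /\ Defs.mem s' = Defs.mem s.

Lemma agree_trans l s1 s2 s3 : agree l s1 s2 -> agree l s2 s3 -> agree l s1 s3.
Proof.
by move=> [r12 m12] [r23 m23]; split=> [i il|]; rewrite ?r23 ?r12 // m23.
Qed.

Lemma agreeW l l' s s' : l <= l' -> agree l' s s' -> agree l s s'.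
Proof. by move=> le [r m]; split=> // i il; apply: r; apply: leq_trans le. Qed.

Lemma agree_set_reg l s i x : l <= i -> agree l s (set_reg s i x).
Proof. by move=> li; split=> // h hl /=; case: eqP => // hi; lia. Qed.

Lemma agree_map l s s' vars :
  all (fun i => i < l) vars -> agree l s s' -> map (reg s') vars = map (reg s) vars.
Proof. by move=> /allP vl [rE _]; apply/eq_in_map => i /vl /rE. Qed.

(** [copy] clears register [i] and then uses it as the zero summand, whence [i <> j]. *)
Lemma runs_copy l s i j (Q : state -> Prop) :
  i <> j -> l <= i ->
  (forall s', agree l s s' -> reg s' i = reg s j ->
    (forall h, h <> i -> reg s' h = reg s h) -> Q s') -> runs (copy i j) s Q 2.
Proof.
move=> ij li HQ.
apply: (@runs_seq _ _ _ (fun s1 => s1 = set_reg s i 0) _ 1 1); first exact: runs_instr.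
move=> _ ->; apply: runs_instr; apply: HQ => /=.
- by apply: agree_trans (agree_set_reg _ _ li) (agree_set_reg _ _ li).
- by rewrite !eqxx addn0; case: eqP => // ji; case: ij.
- by move=> h /eqP/negbTE -> .
Qed.

(** Registers from [l] on form a stack: a second operand is computed above the first, so the frame
    condition keeps the first value and all variables intact. Starting at 3 protects [n] and [L]. *)
Lemma compileP e vars l s :
  3 <= l -> all (fun i => i < l) vars ->
  runs (compile vars l e) s
    (fun s' => agree l s s' /\
       reg s' l = eval (reg s 0) (reg s 2) (Defs.mem s) e (map (reg s) vars))
    (cost e (reg s 2)).
Proof.
have widen v k k' : k <= k' -> all (fun i => i < k) v -> all (fun i => i < k') v.
  by move=> kk' /allP vk; apply/allP => i /vk ik; apply: leq_trans kk'.
have glob m s1 s2 : 3 <= m -> agree m s1 s2 ->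
    [/\ reg s2 0 = reg s1 0, reg s2 2 = reg s1 2 & Defs.mem s2 = Defs.mem s1].
  by move=> m3 [rE ->]; split=> //; apply: rE; lia.
elim: e vars l s => [|i|c|a IHa b IHb|a IHa b IHb|a IHa|a IHa b IHb c IHc
    |a IHa b IHb|a IHa b IHb] vars l s l3 vl /=.
- by apply: (@runs_copy l); [lia| |].
- case: ltnP => [ilt|ile].
    have nl : nth 0 vars i < l by apply: (allP vl); rewrite mem_nth.
    by apply: (@runs_copy l) => // [|s' ? -> _]; [lia|rewrite (nth_map 0)].
  apply: (@runs_weaken _ _ _ _ 1); first by apply: runs_instr; exact: (erefl _).
    by [].
  move=> _ <-; split; first exact: agree_set_reg.
  by rewrite /= eqxx nth_default // size_map.
- by apply: runs_instr; split; [exact: agree_set_reg|rewrite /= eqxx].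
- apply: (runs_seq (IHa _ _ _ l3 vl)) => s1 [ag1 E1].
  have [n1 L1 M1] := glob _ _ _ l3 ag1; rewrite -L1.
  apply: (runs_seq (IHb _ _ _ _ (widen _ _ _ (leqnSn l) vl))); first lia.
  move=> s2 [ag2 E2]; have lt2 := agreeW (leqnSn l) ag2.
  apply: runs_instr; split.
    exact: agree_trans ag1 (agree_trans lt2 (agree_set_reg _ _ _)).
  by rewrite /= eqxx ag2.1 // E1 E2 (agree_map vl ag1) n1 L1 M1.
- apply: (runs_seq (IHa _ _ _ l3 vl)) => s1 [ag1 E1].
  have [n1 L1 M1] := glob _ _ _ l3 ag1; rewrite -L1.
  apply: (runs_seq (IHb _ _ _ _ (widen _ _ _ (leqnSn l) vl))); first lia.
  move=> s2 [ag2 E2]; have lt2 := agreeW (leqnSn l) ag2.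
  apply: runs_instr; split.
    exact: agree_trans ag1 (agree_trans lt2 (agree_set_reg _ _ _)).
  by rewrite /= eqxx ag2.1 // E1 E2 (agree_map vl ag1) n1 L1 M1.
- apply: (runs_seq (IHa _ _ _ l3 vl)) => s1 [ag1 E1].
  apply: runs_instr; split; first exact: agree_trans ag1 (agree_set_reg _ _ _).
  by rewrite /= eqxx E1 ag1.2.
- apply: (runs_seq (IHa _ _ _ l3 vl)) => s1 [ag1 E1].
  have [n1 L1 M1] := glob _ _ _ l3 ag1; rewrite -E1 -L1.
  apply: runs_if => h.
    apply: (runs_weaken (IHb _ _ _ l3 vl)) => // s2 [ag2 ->].
    split; first exact: agree_trans ag2.
    by rewrite (agree_map vl ag1) n1 L1 M1; case: eqP.
  apply: (runs_weaken (IHc _ _ _ l3 vl)) => // s2 [ag2 ->].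
  split; first exact: agree_trans ag2.
  by rewrite (agree_map vl ag1) n1 L1 M1; case: eqP.
- apply: (runs_seq (IHa _ _ _ l3 vl)) => s1 [ag1 E1].
  have [n1 L1 M1] := glob _ _ _ l3 ag1; rewrite -L1.
  have vl' : all (fun i => i < l.+1) (l :: vars) by rewrite /= leqnn; exact: widen vl.
  apply: (runs_seq (IHb _ _ _ _ vl')); first lia.
  move=> s2 [ag2 E2]; have lt2 := agreeW (leqnSn l) ag2.
  apply: (@runs_copy l); [lia|by []|move=> s3 ag3 E3 _].
  split; first exact: agree_trans ag1 (agree_trans lt2 ag3).
  by rewrite E3 E2 /= E1 (agree_map vl ag1) n1 L1 M1.
apply: (runs_seq (IHa _ _ _ l3 vl)) => s1 [ag1 E1].
have [n1 L1 M1] := glob _ _ _ l3 ag1.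
apply: (@runs_seq _ _ _ (fun s' => s' = set_reg s1 l.+1 0)); first exact: runs_instr.
move=> _ ->; set s2 := set_reg _ _ _.
have ag2 : agree l s s2 by apply: agree_trans ag1 (agree_set_reg _ _ _).
(* Loop invariant with [m] iterations left: [l] holds the accumulator, [l.+1] the counter, [l.+2]
   the number [m]; the body is evaluated in [l.+3]. *)
pose F := fun i acc => eval (reg s 0) (reg s 2) (Defs.mem s) b [:: i, acc & map (reg s) vars].
pose I m s' := [/\ m <= reg s 2, agree l s s', reg s' l.+2 = m, reg s' l.+1 = reg s 2 - m
  & reg s' l = iteri (reg s 2 - m) F (eval (reg s 0) (reg s 2) (Defs.mem s) a (map (reg s) vars))].
apply: (@runs_seq _ _ _ (I (reg s 2))).
  apply: (@runs_copy l) => [||s3 ag3 E3 neq]; [lia|lia|split=> //].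
  - exact: agree_trans ag3.
  - by rewrite E3 ag2.1.
  - by rewrite neq ?subnn /= ?eqxx //; lia.
  - rewrite neq; last lia.
    by rewrite subnn /= -E1; case: eqP => //; lia.
have step m s' : I m.+1 s' ->
    runs (Seq (compile [:: l.+1, l & vars] l.+3 b) (Seq (copy l l.+3)
            (Seq (Instr (Const l.+3 1)) (Seq (Instr (Add l.+1 l.+1 l.+3))
              (Instr (Defs.Sub l.+2 l.+2 l.+3)))))) s' (I m) (cost b (reg s 2) + 6).
  case=> mL ag Em Ei Ea; have [n' L' M'] := glob _ _ _ l3 ag.
  have vl' : all (fun i => i < l.+3) [:: l.+1, l & vars].
    by rewrite /= !ltnS leqnSn leqW //=; apply: widen vl; lia.
  rewrite -L'; apply: (runs_seq (IHb _ _ _ _ vl')); first lia.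
  move=> s4 [ag4 E4].
  have lt4 : agree l s' s4 by apply: agreeW ag4; lia.
  apply: (@runs_seq _ _ _ (fun s5 => [/\ agree l s' s5, reg s5 l = reg s4 l.+3,
    reg s5 l.+1 = reg s' l.+1 & reg s5 l.+2 = reg s' l.+2]) _ 2 4).
    apply: (@runs_copy l); [lia|lia|move=> s5 ag5 E5 neq].
    split=> //; first exact: agree_trans ag5.
      by rewrite neq ?ag4.1 //; lia.
    by rewrite neq ?ag4.1 //; lia.
  move=> s5 [ag5 E5 Ei5 Em5].
  apply: (@runs_seq _ _ _ (fun s6 => s6 = set_reg s5 l.+3 1) _ 1 3).
    exact: runs_instr.
  move=> _ ->; set s6 := set_reg _ _ _.
  apply: (@runs_seq _ _ _ (fun s7 => s7 = step (Add l.+1 l.+1 l.+3) s6) _ 1 2).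
    exact: runs_instr.
  move=> _ ->; set s7 := step _ _.
  apply: (@runs_weaken _ _ _ _ 1) => //; first by apply: runs_instr; exact: (erefl _).
  move=> _ <-.
  have ne i j : i <> j -> (i == j) = false by move=> ij; apply/eqP.
  split.
  - lia.
  - apply: agree_trans ag _; apply: agree_trans ag5 _.
    apply: (@agree_trans _ _ s6); first by apply: agree_set_reg; lia.
    apply: (@agree_trans _ _ s7); first by apply: agree_set_reg; lia.
    by apply: agree_set_reg; lia.
  - by rewrite /= !eqxx !ne ?Em5 ?Em; lia.
  - by rewrite /= !eqxx !ne ?Ei5 ?Ei; lia.
  - rewrite /= !ne; try lia.
    rewrite E5 E4 /= Ei Ea (agree_map vl ag) n' L' M'.
    by have -> : reg s 2 - m = (reg s 2 - m.+1).+1 by lia.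
suff loop m s' : I m s' ->
    runs (While l.+2
          (Seq (compile [:: l.+1, l & vars] l.+3 b) (Seq (copy l l.+3)
            (Seq (Instr (Const l.+3 1)) (Seq (Instr (Add l.+1 l.+1 l.+3))
              (Instr (Defs.Sub l.+2 l.+2 l.+3))))))) s' (I 0)
      (m * (cost b (reg s 2) + 7) + 1).
  move=> s3 /loop h; apply: (runs_weaken h) => // s4 [_ ag4 _ _ ->].
  by rewrite subn0.
elim: m s' => [|m IHm] s' Is.
  by apply: runs_while_end => //; case: Is.
have e' : (cost b (reg s 2) + 6 + (m * (cost b (reg s 2) + 7) + 1)).+1
   = m.+1 * (cost b (reg s 2) + 7) + 1 by lia.
rewrite -e'; apply: runs_while_step (step _ _ Is) IHm.
by case: Is => _ _ ->.
Qed.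

(** As [L] is at least 2, constant factors are absorbed into the exponent and a single power of [L]
    suffices. *)
Definition poly_bounded (f : nat -> nat) : Prop :=
  exists b, forall L, 1 < L -> f L <= L ^ b.

Lemma poly_bounded_cst c : poly_bounded (fun=> c).
Proof.
exists c => L L2; apply: (@leq_trans (2 ^ c)); first exact/ltnW/ltn_expl.
by case: c => [|c]; [rewrite !expn0|rewrite leq_exp2r].
Qed.

Lemma poly_bounded_id : poly_bounded id.
Proof. by exists 1 => L _; rewrite expn1. Qed.

Lemma poly_bounded_mul f g :
  poly_bounded f -> poly_bounded g -> poly_bounded (fun L => f L * g L).
Proof.
move=> [a fa] [b gb]; exists (a + b) => L L2.
by rewrite expnD leq_mul ?fa ?gb.
Qed.

Lemma poly_bounded_add f g :
  poly_bounded f -> poly_bounded g -> poly_bounded (fun L => f L + g L).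
Proof.
move=> [a fa] [b gb]; exists (a + b).+1 => L L2.
have ha := fa _ L2; have hb := gb _ L2.
have pa : 0 < L ^ a by rewrite expn_gt0; lia.
have pb : 0 < L ^ b by rewrite expn_gt0; lia.
(* For positive x and y, x + y is at most 2xy, and the factor 2 is paid by one more power of [L]. *)
rewrite expnS expnD; apply: (@leq_trans (2 * (L ^ a * L ^ b))); last first.
  by rewrite leq_mul2r L2 orbT.
by nia.
Qed.

Lemma poly_bounded_cost e : poly_bounded (cost e).
Proof.
have C := poly_bounded_cst; have A := poly_bounded_add.
elim: e => [|i|c|a IHa b IHb|a IHa b IHb|a IHa|a IHa b IHb c IHc|a IHa b IHb|a IHa b IHb] /=.
- exact: C 2.
- exact: C 2.
- exact: C 1.
- exact: A IHa (A _ _ IHb (C 1)).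
- exact: A IHa (A _ _ IHb (C 1)).
- exact: A IHa (C 1).
- have [d h] := A _ _ IHa (A _ _ (C 1) (A _ _ IHb IHc)).
  by exists d => L /h; rewrite add1n.
- exact: A IHa (A _ _ IHb (C 2)).
- exact: A IHa (A _ _ (C 1) (A _ _ (C 2)
    (A _ _ (poly_bounded_mul poly_bounded_id (A _ _ IHb (C 7))) (C 1)))).
Qed.

(** * Terms for digits, walks and packings *)

(** Truth values are 0 and 1. Truncated subtraction makes [Not] a test for zero, and [Forall] says
    that the number of counterexamples is zero. *)
Definition Sum (a : term) : term := Loop (Cst 0) (Plus (Var 1) a).
Definition Not (a : term) : term := Minus (Cst 1) a.
Definition Le (a b : term) : term := Not (Minus a b).
Definition Lt (a b : term) : term := Le (Plus (Cst 1) a) b.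
Definition Eq (a b : term) : term := Not (Plus (Minus a b) (Minus b a)).
Definition And (a b : term) : term := Ite a b (Cst 0).
Definition Or (a b : term) : term := Ite a (Cst 1) b.
Definition Forall (a : term) : term := Not (Sum (Not a)).
Definition Exists (a : term) : term := Not (Forall (Not a)).

(* Each term below is a function of the first variables of its environment,
   which are listed on its right; [_] is the accumulator of an enclosing sum. *)
Definition Mul : term := (* x y *)
  Sum (Ite (Lt (Var 0) (Var 2)) (Var 3) (Cst 0)).
Definition Quotient : term := (* m *)
  Sum (Le (Bind Order (Bind (Plus (Cst 1) (Var 1)) Mul)) (Var 2)).
Definition Remainder : term := (* m *)
  Minus (Var 0) (Bind Order (Bind (Bind (Var 1) Quotient) Mul)).
Definition Digit : term := (* m i *)
  Bind (Loop (Var 0) (Ite (Lt (Var 0) (Var 3)) (Bind (Var 1) Quotient) (Var 1)))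
    Remainder.
Definition Step : term := (* y x *)
  Or (Eq (Var 1) (Var 0))
     (Fetch (Plus (Bind Order (Bind (Var 2) Mul)) (Var 0))).
Definition Walk : term := (* w _ v u r *)
  And (Eq (Bind (Cst 0) (Bind (Var 1) Digit)) (Var 2))
  (And (Eq (Bind (Var 4) (Bind (Var 1) Digit)) (Var 3))
    (Forall (Or (Le (Var 6) (Var 0))
      (Bind (Bind (Var 0) (Bind (Var 3) Digit))
        (Bind (Bind (Plus (Cst 1) (Var 1)) (Bind (Var 4) Digit)) Step))))).
Definition Reach : term := (* v u r *)
  Exists Walk.
Definition Count : term := (* r _ v _ m _ j *)
  Sum (And (Lt (Var 0) (Var 8))
    (Bind (Var 2) (Bind (Bind (Var 1) (Bind (Var 8) Digit)) (Bind (Var 6) Reach)))).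
Definition Packing : term := (* j *)
  Exists (Forall (Forall
    (Or (Le Order (Var 2)) (Or (Not (Var 0)) (Or (Le (Var 6) (Var 0))
      (Le Count (Var 0))))))).

Definition digit (n m i : nat) : nat := m %/ n ^ i %% n.

(** * Semantics of the arithmetic terms *)

Section Semantics.
Variables (n L : nat) (adj : pred nat).
Hypothesis (n_gt0 : 0 < n).
Local Notation ev := (eval n L (fun a => nat_of_bool (adj a))).

Lemma eval_Bind a b env : ev (Bind a b) env = ev b (ev a env :: env).
Proof. by []. Qed.

Lemma eval_Loop a b env (g : nat -> nat) :
  ev a env = g 0 -> (forall i, i < L -> ev b [:: i, g i & env] = g i.+1) ->
  ev (Loop a b) env = g L.
Proof.
move=> /= -> bg; set f := (f in iteri _ f).
suff E l : l <= L -> iteri l f (g 0) = g l by exact: E.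
by elim: l => // l IHl lL; rewrite iteriS IHl ?(ltnW lL) // /f bg.
Qed.

(** The universally quantified [x] is the accumulator: the summand must not depend on it. *)
Lemma eval_Sum a env F :
  (forall i x, i < L -> ev a [:: i, x & env] = F i) ->
  ev (Sum a) env = \sum_(i < L) F i.
Proof.
move=> aF; apply: (@eval_Loop _ _ _ (fun l => \sum_(i < l) F i)) => [|i iL].
  by rewrite big_ord0.
by rewrite /= aF // big_ord_recr.
Qed.

Lemma eval_Not a env (p : bool) : ev a env = p -> ev (Not a) env = ~~ p.
Proof. by rewrite /Not /= => ->; case: p. Qed.

Lemma eval_Not_nat a env : ev (Not a) env = (ev a env == 0).
Proof. by rewrite /Not /=; lia. Qed.

Lemma eval_Le a b env : ev (Le a b) env = (ev a env <= ev b env).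
Proof. by rewrite /Le eval_Not_nat. Qed.

Lemma eval_Lt a b env : ev (Lt a b) env = (ev a env < ev b env).
Proof. by rewrite /Lt eval_Le. Qed.

Lemma eval_Eq a b env : ev (Eq a b) env = (ev a env == ev b env).
Proof. by rewrite /Eq eval_Not_nat /=; lia. Qed.

Lemma eval_And a b env (p q : bool) :
  ev a env = p -> (p -> ev b env = q) -> ev (And a b) env = (p && q).
Proof. by rewrite /And /= => ->; case: p => // ->. Qed.

Lemma eval_Or a b env (p q : bool) :
  ev a env = p -> (~~ p -> ev b env = q) -> ev (Or a b) env = (p || q).
Proof. by rewrite /Or /= => ->; case: p => // ->. Qed.

Lemma eval_Forall a env (P : pred nat) :
  (forall i x, i < L -> ev a [:: i, x & env] = P i) ->
  ev (Forall a) env = [forall i : 'I_L, P i].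
Proof.
move=> aP; rewrite /Forall eval_Not_nat (@eval_Sum _ _ (fun i => ~~ P i)).
  by rewrite sum_nat_eq0; congr nat_of_bool; apply: eq_forallb => i; case: (P i).
by move=> i x iL; apply/eval_Not/aP.
Qed.

Lemma eval_Exists a env (P : pred nat) :
  (forall i x, i < L -> ev a [:: i, x & env] = P i) ->
  ev (Exists a) env = [exists i : 'I_L, P i].
Proof.
move=> aP; rewrite -[X in nat_of_bool X]negbK negb_exists.
apply: eval_Not; apply: (@eval_Forall _ _ (fun i => ~~ P i)) => i x iL.
by apply/eval_Not/aP.
Qed.

Local Opaque Sum Not Le Lt Eq And Or Forall Exists.

Lemma sum_lt (x : nat) : x <= L -> \sum_(i < L) (i < x) = x.
Proof.
suff E l : \sum_(i < l) (i < x) = minn l x by rewrite E => /minn_idPr.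
elim: l => [|l IHl]; first by rewrite big_ord0 min0n.
by rewrite big_ord_recr /= IHl; lia.
Qed.

Lemma eval_Mul x y env : x <= L -> ev Mul [:: x, y & env] = x * y.
Proof.
move=> xL; rewrite /Mul (@eval_Sum _ _ (fun i => (i < x) * y)).
  by rewrite -big_distrl /= sum_lt.
by move=> i z _ /=; rewrite eval_Lt /=; case: ltnP; rewrite ?mul1n.
Qed.

Local Opaque Mul.

(** The quotient is the number of q with (q + 1)n at most m, and all of these are below [L]. *)
Lemma eval_Quotient m env : m < L -> ev Quotient (m :: env) = m %/ n.
Proof.
move=> mL; rewrite /Quotient (@eval_Sum _ _ (fun q => q < m %/ n)).
  by rewrite sum_lt // ltnW // (leq_ltn_trans (leq_div m n)).
by move=> q x qL; rewrite eval_Le /= eval_Mul // leq_divRL.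
Qed.

Local Opaque Quotient.

Lemma eval_Remainder m env : m < L -> ev Remainder (m :: env) = m %% n.
Proof.
move=> mL; rewrite /Remainder /= eval_Quotient // eval_Mul.
  by rewrite {1}(divn_eq m n) addKn.
by rewrite ltnW // (leq_ltn_trans (leq_div m n)).
Qed.

Local Opaque Remainder.

Lemma eval_Digit m i env :
  m < L -> i <= L -> ev Digit [:: m, i & env] = digit n m i.
Proof.
move=> mL iL; rewrite /Digit.
have E : ev (Loop (Var 0) (Ite (Lt (Var 0) (Var 3)) (Bind (Var 1) Quotient) (Var 1)))
    [:: m, i & env] = m %/ n ^ i.
  rewrite -{2}(minn_idPr iL).
  (* The loop always runs [L] times but divides by [n] only in its first [i] rounds. *)
  apply: (@eval_Loop _ _ _ (fun l => m %/ n ^ minn l i)) => [|l lL].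
    by rewrite min0n divn1.
  rewrite /= eval_Lt /=; case: ltnP => il /=.
    rewrite eval_Quotient ?(leq_ltn_trans (leq_div m _)) //.
    by rewrite -divnMA -expnSr (minn_idPl il).
  by rewrite (minn_idPr (leqW il)).
rewrite eval_Bind E eval_Remainder //.
exact: leq_ltn_trans (leq_div m _) mL.
Qed.

Local Opaque Digit.

Definition steps (x y : nat) : bool := (x == y) || adj (x * n + y).

Definition walks (w v u r : nat) : bool :=
  [&& digit n w 0 == v, digit n w r == u &
    [forall i : 'I_L, (r <= i) || steps (digit n w i) (digit n w i.+1)]].

Definition reaches (v u r : nat) : bool := [exists w : 'I_L, walks w v u r].

(** Quantifiers range over all numbers below [L]; the first three disjuncts discard non-vertices and
    the radii outside 0 < r < j. *)
Definition packs (m j : nat) : bool :=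
  [forall v : 'I_L, forall r : 'I_L, [|| n <= v, r == 0 :> nat, j <= r |
    \sum_(i < L) ((i < j) && reaches v (digit n m i) r) <= r]].

Lemma eval_Step x y env : x <= L -> ev Step [:: y, x & env] = steps x y.
Proof.
move=> xL; apply: eval_Or; first by rewrite eval_Eq.
by move=> _ /=; rewrite eval_Mul.
Qed.

Local Opaque Step.

Hypothesis n_leL : n <= L.

Lemma digit_lt m i : digit n m i < n.
Proof. exact: ltn_pmod. Qed.

Lemma digit_leL m i : digit n m i <= L.
Proof. by apply: leq_trans n_leL; exact/ltnW/digit_lt. Qed.

Lemma eval_Walk w x v u r env :
  w < L -> r <= L -> ev Walk [:: w, x, v, u, r & env] = walks w v u r.
Proof.
move=> wL rL; apply: eval_And; first by rewrite eval_Eq /= eval_Digit.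
move=> _; apply: eval_And; first by rewrite eval_Eq /= eval_Digit.
move=> _; apply: (@eval_Forall _ _ (fun i =>
  (r <= i) || steps (digit n w i) (digit n w i.+1))) => i y iL.
apply: eval_Or; first by rewrite eval_Le.
by move=> _ /=; rewrite !eval_Digit ?(ltnW iL) // eval_Step ?digit_leL.
Qed.

Local Opaque Walk.

Lemma eval_Reach v u r env : r <= L -> ev Reach [:: v, u, r & env] = reaches v u r.
Proof.
move=> rL; apply: (@eval_Exists _ _ (fun w => walks w v u r)) => w x wL.
by rewrite eval_Walk.
Qed.

Local Opaque Reach.

Lemma eval_Packing j env :
  ev Packing (j :: env) = [exists m : 'I_L, packs m j].
Proof.
apply: (@eval_Exists _ _ (fun m => packs m j)) => m x0 mL.
apply: (@eval_Forall _ _ (fun v => [forall r : 'I_L, [|| n <= v, r == 0 :> nat, j <= r |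
    \sum_(i < L) ((i < j) && reaches v (digit n m i) r) <= r]])) => v x1 vL.
apply: (@eval_Forall _ _ (fun r => [|| n <= v, r == 0 :> nat, j <= r |
    \sum_(i < L) ((i < j) && reaches v (digit n m i) r) <= r])) => r x2 rL.
apply: eval_Or; first by rewrite eval_Le.
move=> _; apply: eval_Or; first by rewrite eval_Not_nat.
move=> _; apply: eval_Or; first by rewrite eval_Le.
move=> _; rewrite eval_Le; congr (nat_of_bool (_ <= _)).
rewrite (@eval_Sum _ _ (fun i => (i < j) && reaches v (digit n m i) r)) //.
move=> i x3 iL; apply: eval_And; first by rewrite eval_Lt.
by move=> _ /=; rewrite eval_Digit ?(ltnW iL) // eval_Reach // ltnW.
Qed.

End Semantics.

(** * Multipackings as tuples of digits *)

Section Balls.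
Variables (T : finType) (e : rel T).

Lemma has_dpathP (u v : T) (l : nat) :
  reflect (exists p, [/\ path e u p, last u p = v, uniq (u :: p) & size p = l])
          (has_dpath e u v l).
Proof.
apply: (iffP existsP) => [[p /and3P[up /eqP pv uq]]|[p [up pv uq pl]]].
  by exists p; split=> //; rewrite size_tuple.
have sp : size p == l by apply/eqP.
by exists (Tuple sp); rewrite up pv eqxx uq.
Qed.

(** Every path shortens to one without repetition, whose length is below #|T| and hence found by the
    search; the list of lengths is sorted, so its head is minimal. *)
Lemma distP (u v : T) (r : nat) :
  reflect (exists p, [/\ path e u p, last u p = v & size p <= r])
          (if dist e u v is Some l then l <= r else false).
Proof.
apply: (iffP idP) => [|[p [up pv pr]]].
  rewrite /dist; set s := filter _ _.
  have : {subset s <= has_dpath e u v} by move=> l; rewrite mem_filter => /andP[].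
  case: s => //= l s /(_ l (mem_head _ _)) /has_dpathP[p [up pv _ <-]] pr.
  by exists p.
case/shortenP: up pv => q uq q_uniq /(uniq_leq_size (andP q_uniq).2) qp qv.
have qn : size q < #|T| by have := max_card (mem (u :: q)); rewrite (card_uniqP q_uniq).
rewrite /dist; set s := filter _ _.
have qs : size q \in s.
  by rewrite mem_filter mem_iota add0n qn !andbT; apply/has_dpathP; exists q.
have : sorted leq s by apply: sorted_filter (iota_sorted _ _); exact: leq_trans.
case: s qs => //= l s; rewrite inE => /predU1P[<- _|qs].
  exact: leq_trans qp pr.
rewrite (path_sortedE leq_trans) => /andP[/allP/(_ _ qs) lq _].
by apply: leq_trans lq (leq_trans qp pr).
Qed.

Lemma mem_out_ball (u v : T) (r : nat) :
  reflect (exists p, [/\ path e v p, last v p = u & size p <= r])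
          (u \in out_ball e r v).
Proof. by rewrite inE; exact: distP. Qed.

Lemma out_ball_center (r : nat) (v : T) : v \in out_ball e r v.
Proof. by apply/mem_out_ball; exists [::]. Qed.

Lemma out_ball_edge (r : nat) (u v w : T) :
  u \in out_ball e r v -> e u w -> w \in out_ball e r.+1 v.
Proof.
move=> /mem_out_ball[p [vp pu pr]] uw; apply/mem_out_ball; exists (rcons p w).
by rewrite rcons_path vp pu last_rcons size_rcons.
Qed.

Lemma out_ball_mono (r r' : nat) (v : T) :
  r <= r' -> out_ball e r v \subset out_ball e r' v.
Proof.
move=> rr'; apply/subsetP => u /mem_out_ball[p [vp pu pr]].
by apply/mem_out_ball; exists p; rewrite vp (leq_trans pr).
Qed.

Lemma out_ball_diameter (d : nat) (v : T) :
  diameter e = Some d -> out_ball e d v = setT.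
Proof.
rewrite /diameter; case: ifP => // /forallP/(_ v)/forallP dv [<-].
apply/setP => u; rewrite !inE; have := dv u; case E: (dist e v u) => [l|] // _.
have -> : l = odflt 0 (dist e v u) by rewrite E.
apply: leq_trans (leq_bigmax v); exact: leq_bigmax u.
Qed.

Lemma sum_mem_inj (j : nat) (F : 'I_j -> T) (B : {set T}) :
  injective F -> \sum_(i < j) (F i \in B) = #|B :&: F @: setT|.
Proof.
move=> Finj; rewrite -sum1_card.
rewrite (eq_bigl (fun x => (x \in F @: setT) && (x \in B))); last first.
  by move=> x; rewrite inE andbC.
rewrite big_imset_cond /=; last by move=> ? ? _ _; exact: Finj.
rewrite [RHS]big_mkcond; apply: eq_bigr => i _.
by rewrite inE; case: (_ \in _).
Qed.

Definition tuple_packing (j : nat) (F : 'I_j -> T) : Prop :=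
  forall v r, 0 < r < j -> \sum_(i < j) (F i \in out_ball e r v) <= r.

(* Two equal entries would both lie in the unit ball around their value. *)
Lemma tuple_packing_inj (j : nat) (F : 'I_j -> T) : tuple_packing F -> injective F.
Proof.
move=> FP a b Fab; apply/eqP/negPn/negP => ab.
have j1 : 0 < 1 < j.
  by have := ltn_ord a; have := ltn_ord b; move: ab; rewrite -val_eqE /=; lia.
have := FP (F a) 1 j1; rewrite (bigD1 a) //= (bigD1 b) 1?eq_sym //=.
by rewrite -Fab out_ball_center.
Qed.

Lemma has_tuple_packing (j : nat) :
  (exists F : 'I_j -> T, tuple_packing F) <-> has_multipacking e j.
Proof.
split=> [[F FP]|[S SP jS]].
  have Finj := tuple_packing_inj FP.
  exists (F @: setT); last by rewrite card_imset // cardsT card_ord.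
  move=> v r r0; case: (ltnP r j) => rj; last first.
    (* For radii at least [j] the condition is automatic, the image having only [j] elements. *)
    apply: leq_trans (subset_leq_card (subsetIr _ _)) _.
    by rewrite card_imset // cardsT card_ord.
  have rj' : 0 < r < j by rewrite r0.
  by rewrite -sum_mem_inj //; exact: FP.
pose F (i : 'I_j) := enum_val (widen_ord jS i).
have Finj : injective F.
  by move=> a b /enum_val_inj/(congr1 (@nat_of_ord _))/= ab; exact: val_inj.
exists F => v r /andP[r0 _]; rewrite sum_mem_inj //.
apply: leq_trans (SP v r r0); apply/subset_leq_card/setIS/subsetP => x.
by case/imsetP => i _ ->; exact: enum_valP.
Qed.

Lemma has_multipackingW (j k : nat) :
  k <= j -> has_multipacking e j -> has_multipacking e k.
Proof. by move=> kj [S SP jS]; exists S => //; exact: leq_trans jS. Qed.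

(** This makes the search terminate even when the diameter is infinite. *)
Lemma has_multipacking_card (j : nat) : has_multipacking e j -> j <= #|T|.
Proof. by move=> [S _ jS]; apply: leq_trans jS (max_card _). Qed.

(** The ball condition starts at radius 1, whence the maximum when [d] is 0. *)
Lemma has_multipacking_diameter (d j : nat) :
  diameter e = Some d -> has_multipacking e j -> j <= maxn d 1.
Proof.
move=> De [S SP jS]; apply: leq_trans jS _.
have [->|[v _]] := set_0Vmem S; first by rewrite cards0.
have := SP v (maxn d 1); rewrite leq_max orbT => /(_ isT).
suff -> : out_ball e (maxn d 1) v = setT by rewrite setTI.
by apply/eqP; rewrite -subTset -(out_ball_diameter v De) out_ball_mono // leq_maxl.
Qed.

Lemma diameter_gt0 (d : nat) : 1 < #|T| -> diameter e = Some d -> 0 < d.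
Proof.
case: d => // /card_gt1P[u [v [_ _ /eqP uv]]] /(@out_ball_diameter _ u) B0.
have /mem_out_ball[p [_ pv]] : v \in out_ball e 0 u by rewrite B0 inE.
by case: p pv.
Qed.

End Balls.

(** Horner's scheme: [g 0] is the lowest digit, and the shifted sequence gives the others. *)
Lemma digit_surj (n j : nat) (g : nat -> nat) :
  (forall i, i < j -> g i < n) ->
  exists2 m, m < n ^ j & forall i, i < j -> digit n m i = g i.
Proof.
elim: j g => [|j IHj] g gn; first by exists 0.
have [|m mn mg] := IHj (g \o succn); first by move=> i ij; exact: gn.
have g0 := gn 0 isT; have n0 : 0 < n by apply: leq_ltn_trans g0.
exists (m * n + g 0).
  by rewrite expnSr -ltn_divLR // divnMDl // divn_small // addn0.
case=> [_|i ij]; first by rewrite /digit divn1 modnMDl modn_small.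
by rewrite -[RHS](mg i ij) /digit expnS divnMA divnMDl // (divn_small g0) addn0.
Qed.

(** * Correctness of the encoding by digits *)

Section Encoding.
Variables (n : nat) (e : rel 'I_n) (L : nat).
Hypothesis n_gt0 : 0 < n.

Definition adjacency (a : nat) : bool :=
  [exists u : 'I_n, exists v : 'I_n, (a == u * n + v) && e u v].

Lemma adjacencyE (u v : 'I_n) : adjacency (u * n + v) = e u v.
Proof.
apply/existsP/idP => [[u' /existsP[v' /andP[/eqP E euv]]]|euv].
  have [Eu Ev] : u = u' /\ v = v'.
    split; apply: val_inj => /=.
      by have := congr1 (divn^~ n) E; rewrite !divnMDl // !divn_small // !addn0.
    by have := congr1 (modn^~ n) E; rewrite !modnMDl !modn_small.
  by rewrite Eu Ev.
by exists u; apply/existsP; exists v; rewrite eqxx.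
Qed.

Lemma stepsE (u v : 'I_n) : steps n adjacency u v = (u == v) || e u v.
Proof. by rewrite /steps adjacencyE. Qed.

Definition digit_ord (m i : nat) : 'I_n := Ordinal (digit_lt n_gt0 m i).

(** A walk of [r] steps has r + 1 vertices, whence the power of [n]. Dropping stationary steps gives
    a path of length at most [r]; conversely, a short path is padded by waiting at its end. *)
Lemma reachesE (u v : 'I_n) (r : nat) :
  r < L -> n ^ r.+1 <= L -> reaches n L adjacency v u r = (u \in out_ball e r v).
Proof.
move=> rL nL; apply/existsP/idP => [[w /and3P[/eqP w0 /eqP wr /forallP wS]]|].
  have -> : u = digit_ord w r by apply: val_inj.
  (* Induction on the prefixes of a fixed walk: its vertex number i lies in the ball of radius i. *)
  elim: {-2}r (leqnn r) => [|i IHi] ir.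
    by rewrite (_ : digit_ord w 0 = v) ?out_ball_center //; exact: val_inj.
  have iL : i < L by apply: leq_trans rL; exact: leqW.
  have := wS (Ordinal iL); rewrite /= leqNgt ir /=.
  rewrite (stepsE (digit_ord w i) (digit_ord w i.+1)).
  case/orP=> [/eqP <-|]; last exact/out_ball_edge/IHi/ltnW.
  by apply: (subsetP (out_ball_mono _ _ (leqnSn i))); exact/IHi/ltnW.
case/mem_out_ball => p [vp pu pr].
(* The default value [u] of [nth] does the padding. *)
have [|w wn wg] := @digit_surj n r.+1 (fun i => nth u (v :: p) i).
  by move=> i _; exact: ltn_ord.
have wL : w < L by apply: leq_trans nL.
exists (Ordinal wL); apply/and3P; split=> /=; rewrite ?wg //.
  apply/eqP; congr nat_of_ord; case: (ltngtP (size p) r) pr => // [pr|<-] _.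
    by rewrite nth_default.
  by rewrite nth_last.
apply/forallP => i; rewrite leqNgt; case: ltnP => //= ir.
rewrite (wg i (leqW ir)) (wg i.+1 ir) stepsE.
have [ip|pi] := ltnP i (size p); first by rewrite ((pathP u vp) i ip) orbT.
rewrite -[nth u (v :: p) i.+1]/(nth u p i) [nth u p i]nth_default //.
move: pi; rewrite leq_eqVlt => /predU1P[<-|pi]; last by rewrite nth_default ?eqxx.
by rewrite nth_last /= pu eqxx.
Qed.

(** As only radii r < j occur, walks need at most [j] digits, so the bound on n ^ j serves tuples
    and walks alike. *)
Lemma packsE (m j : nat) :
  n ^ j <= L -> n <= L -> j <= L ->
  packs n L adjacency m j <-> tuple_packing e (fun i : 'I_j => digit_ord m i).
Proof.
move=> njL nL jL.
have E (v : 'I_n) r : 0 < r < j ->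
    \sum_(i < L) ((i < j) && reaches n L adjacency v (digit n m i) r) =
    \sum_(i < j) (digit_ord m i \in out_ball e r v).
  case/andP=> r0 rj.
  rewrite (big_ord_widen _ (fun i => nat_of_bool (digit_ord m i \in out_ball e r v)) jL).
  rewrite [RHS]big_mkcond; apply: eq_bigr => i _; case: ltnP => //= ij.
  rewrite -reachesE //; first exact: leq_trans jL.
  by apply: leq_trans njL; rewrite leq_pexp2l.
split=> [/forallP pk v r rj|pk].
  have vL : v < L by apply: leq_trans nL.
  have rL : r < L by case/andP: rj => _ rj; apply: leq_trans jL.
  have := pk (Ordinal vL) => /forallP/(_ (Ordinal rL)) /=.
  rewrite leqNgt ltn_ord /= E //.
  by case/andP: rj => r0 rj; rewrite eqn0Ngt r0 leqNgt rj.
apply/forallP => v; apply/forallP => r.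
case: leqP => //= vn; case: eqP => //= /eqP; rewrite -lt0n => r0.
case: leqP => //= rj; rewrite (E (Ordinal vn)) ?r0 //.
by apply: pk; rewrite r0.
Qed.

Lemma exists_packs (j : nat) :
  n ^ j <= L -> n <= L -> j <= L ->
  [exists m : 'I_L, packs n L adjacency m j] <-> has_multipacking e j.
Proof.
move=> njL nL jL; rewrite -has_tuple_packing; split=> [/existsP[m]|[F FP]].
  by rewrite packsE // => FP; eexists; exact: FP.
have [|m mn mF] := @digit_surj n j (fun i => if insub i is Some k then F k else 0).
  by move=> i ij; rewrite insubT.
have mL : m < L by apply: leq_trans njL.
apply/existsP; exists (Ordinal mL); apply/packsE => // v r /(FP v r).
rewrite (eq_bigr (fun i : 'I_j => nat_of_bool (digit_ord m i \in out_ball e r v))) //.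
move=> i _; rewrite (_ : F i = digit_ord m i) //; apply: val_inj => /=.
by rewrite mF // valK.
Qed.

End Encoding.

(** * The search *)

Local Opaque Packing.

Lemma leq_expnl (m n b : nat) : m <= n -> m ^ b <= n ^ b.
Proof. by case: b => [|b] mn; rewrite ?expn0 // leq_exp2r. Qed.

(* Registers: 0 holds n, 1 holds k, 2 the bound L, 3 the current size, and 4
   whether there is a multipacking of that size. *)
Definition next_size : program :=
  Seq (compile [::] 5 (Sum (Plus Order (Cst 1)))) (Seq (copy 2 5)
    (Seq (Instr (Const 5 1)) (Seq (Instr (Add 3 3 5)) (compile [:: 3] 4 Packing)))).

(** Register 4 starts at 1 because size 0 is always possible; the same 1 gives the initial bound n +
    1. On exit register 3 holds the first impossible size J, and J - k is nonzero exactly when k <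
    J. *)
Definition decide_multipacking : program :=
  Seq (Instr (Const 4 1)) (Seq (Instr (Add 2 0 4))
    (Seq (While 4 next_size) (Instr (Defs.Sub 0 3 1)))).

(** The base n + 1 instead of [n] keeps the bound above 1 and above [j] even for n = 1. *)
Definition loop_inv (n : nat) (e : rel 'I_n) (k j : nat) (s : state) : Prop :=
  [/\ [/\ reg s 0 = n, reg s 1 = k & reg s 3 = j], reg s 2 = n.+1 ^ j.+1,
      Defs.mem s = (fun a => nat_of_bool (adjacency e a)) &
      reg s 4 <> 0 <-> has_multipacking e j].

Lemma next_size_runs :
  exists b, forall (n : nat) (e : rel 'I_n) (k j : nat) (s : state),
    0 < n -> loop_inv e k j s ->
    runs next_size s (loop_inv e k j.+1) ((n.+1 ^ j.+2) ^ b).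
Proof.
have [b1 H1] := poly_bounded_cost (Sum (Plus Order (Cst 1))).
have [b2 H2] := poly_bounded_cost Packing.
have pexp b : poly_bounded (fun x => x ^ b) by exists b.
(* The three summands are the update of the bound, four single instructions, and [Packing] run with
   the new bound. *)
have [b Hb] := poly_bounded_add (pexp b1)
  (poly_bounded_add (poly_bounded_cst 4) (pexp b2)).
exists b => n e k j s n0 [[rn rk rj] rL rM r4].
set L := n.+1 ^ j.+2.
have nL : n < L by apply: (@leq_trans (n.+1 ^ 1)); [rewrite expn1|rewrite leq_pexp2l].
have L1 : 1 < L by apply: leq_trans nL; rewrite ltnS.
have jL : j.+1 < L by apply: (@leq_trans (n.+1 ^ j.+1)); [rewrite ltn_expl|rewrite leq_pexp2l].
have njL : n ^ j.+1 <= L.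
  apply: (@leq_trans (n.+1 ^ j.+1)); first by rewrite leq_exp2r.
  by rewrite leq_pexp2l.
have sL : 1 < reg s 2 <= L.
  rewrite rL; apply/andP; split; last by rewrite leq_pexp2l.
  by rewrite -[2]/(1.+1) -(exp1n j.+1) ltn_exp2r // ltnS.
case/andP: sL => s1 sL.
apply: (@runs_weaken _ _ (loop_inv e k j.+1) _
    (cost (Sum (Plus Order (Cst 1))) (reg s 2) + (2 + (1 + (1 + cost Packing L))))) => //;
  last first.
  apply: leq_trans (Hb _ L1); apply: leq_add; last first.
    by rewrite (leq_add2l 4) H2.
  exact: leq_trans (H1 _ s1) (leq_expnl _ sL).
apply: (runs_seq (@compileP _ [::] 5 s _ _)) => // s1' [[ag1 ag1m] E1].
(* Summing n + 1 over as many rounds as the old bound multiplies that bound by n + 1. *)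
have {}E1 : reg s1' 5 = L.
  rewrite E1 rM (@eval_Sum _ _ _ _ _ (fun=> n + 1)) //; last by rewrite rn.
  by rewrite sum_nat_const card_ord rL addn1 -expnSr.
apply: (@runs_seq _ _ _ (fun s2 => [/\ reg s2 0 = n, reg s2 1 = k, reg s2 2 = L, reg s2 3 = j
   & Defs.mem s2 = (fun a => nat_of_bool (adjacency e a))])).
  apply: (@runs_copy 2) => // s2 [_ mE] r2 rne.
  by split; rewrite ?r2 ?E1 ?rne ?ag1 ?mE ?ag1m.
move=> s2 [n2 k2 L2 j2 M2].
apply: (@runs_seq _ _ _ (fun s3 => s3 = set_reg s2 5 1) _ 1); first exact: runs_instr.
move=> _ ->; set s3 := set_reg _ _ _.
apply: (@runs_seq _ _ _ (fun s4 => s4 = step (Add 3 3 5) s3) _ 1); first exact: runs_instr.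
move=> _ ->; set s4 := step _ _.
have s42 : reg s4 2 = L by [].
have s43 : reg s4 3 = j.+1 by rewrite /= j2 addn1.
rewrite -s42; apply: (runs_weaken (@compileP _ _ _ _ _ _)) => //.
move=> s5 [[ag5 ag5m] E5]; split.
- by rewrite !ag5 // n2 k2 s43.
- by rewrite ag5 // s42.
- by rewrite ag5m M2.
have env4 : map (reg s4) [:: 3] = [:: j.+1] by rewrite -s43.
have n4 : reg s4 0 = n by [].
have M4 : Defs.mem s4 = (fun a => nat_of_bool (adjacency e a)) by [].
rewrite E5 env4 n4 M4 s42 eval_Packing //; last exact: ltnW.
rewrite -(exists_packs e n0 njL (ltnW nL) (ltnW jL)).
by case: existsP; split.
Qed.

Lemma has_multipacking0 (T : finType) (e : rel T) : has_multipacking e 0.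
Proof. by exists set0 => // v r _; rewrite setI0 cards0. Qed.

Lemma search_runs :
  exists b, forall (n : nat) (e : rel 'I_n) (k j : nat) (s : state),
    0 < n -> loop_inv e k j s -> exists J,
    [/\ j <= J, ~ has_multipacking e J, j < J -> has_multipacking e J.-1
      & runs (While 4 next_size) s (loop_inv e k J)
          ((J - j) * ((n.+1 ^ J.+1) ^ b).+1 + 1)].
Proof.
have [b Hb] := next_size_runs; exists b => n e k j s n0.
have [f] := ubnP (n.+1 - j); elim: f j s => // f IHf j s jf Is.
have [_ _ _ r4] := Is.
have [s4|/eqP s4] := eqVneq (reg s 4) 0.
  exists j; split=> //; first by move/r4.
    by rewrite ltnn.
  by rewrite subnn; exact: runs_while_end.
have mj := r4.1 s4; have := has_multipacking_card mj; rewrite card_ord => jn.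
have [s1 [t1 [ex1 le1 I1]]] := Hb _ _ _ _ _ n0 Is.
have [||J [jJ NJ mJ [s2 [t2 [ex2 le2 I2]]]]] := IHf j.+1 s1; [lia|exact: I1|].
exists J; split=> //; first exact: ltnW.
  (* If J = j + 1, its predecessor is the size [j] just found possible. *)
  by move: jJ mJ; rewrite leq_eqVlt => /predU1P[<- _ _ //|jJ /(_ jJ)].
exists s2, (t1 + t2).+1; split=> //; first exact: exec_while_true ex2.
(* Bounds grow with the size, so every round is charged the price of the last one. *)
have {}le1 : t1 <= (n.+1 ^ J.+1) ^ b.
  apply: leq_trans le1 _; have lx : n.+1 ^ j.+2 <= n.+1 ^ J.+1 by rewrite leq_pexp2l.
  exact: leq_expnl.
have -> : J - j = (J - j.+1).+1 by lia.
by rewrite mulSn; lia.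
Qed.

Theorem theorem20 :
  exists (p : program) (c : nat),
    forall (n : nat) (e : rel 'I_n) (k : nat),
      0 < n -> weakly_connected e ->
      exists (s : state) (t : nat),
        [/\ exec p (input e k) s t,
            accepting s <-> has_multipacking e k
          & forall d : nat, diameter e = Some d -> t <= c * n ^ (c * d)].
Proof.
have [b Hb] := search_runs.
(* Here X is (n + 1) ^ (J + 1), which exceeds the number J of rounds; the 4 counts the two initial
   instructions, the last test and the final subtraction. *)
have [b' Hb'] : poly_bounded (fun X => X * (X ^ b + 1) + 4).
  apply: poly_bounded_add (poly_bounded_cst 4).
  apply: poly_bounded_mul poly_bounded_id _.
  by apply: poly_bounded_add (poly_bounded_cst 1); exists b.
(* The first summand pays for n = 1, where the power of [n] is 1, J is at most 2 and the time at
   most 2 ^ (3b'). The second serves n > 1: there n + 1 is at most n ^ 2 and J + 1 at most d + 2,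
   hence at most 3d, giving the exponent 6b'd. *)
exists decide_multipacking, (2 ^ (3 * b') + 6 * b') => n e k n0 _.
set c := _ + _.
pose s0 := step (Add 2 0 4) (step (Const 4 1) (input e k)).
have I0 : loop_inv e k 0 s0.
  by split=> //=; [rewrite addn1 expn1|split=> // _; exact: has_multipacking0].
have [J [_ NJ mJ loop]] := Hb _ _ _ _ _ n0 I0.
have J0 : 0 < J by case: (J) NJ => // /(_ (has_multipacking0 e)).
have {}mJ := mJ J0.
have [s [t [exP tle sE]]] : runs decide_multipacking (input e k)
   (fun s => reg s 0 = J - k) (1 + (1 + (J * ((n.+1 ^ J.+1) ^ b).+1 + 1 + 1))).
  apply: (@runs_seq _ _ _ (fun s => s = step (Const 4 1) (input e k))).
    exact: runs_instr.
  move=> _ ->; apply: (@runs_seq _ _ _ (fun s => s = s0)); first exact: runs_instr.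
  move=> _ ->; rewrite subn0 in loop; apply: (runs_seq loop) => s1 [[_ r1 r3] _ _ _].
  by apply: runs_instr; rewrite /= r1 r3.
exists s, t; split=> //.
  rewrite /accepting sE; split=> [Jk|mk].
    by apply: has_multipackingW mJ; lia.
  by move=> Jk; apply: NJ; apply: has_multipackingW mk; lia.
move=> d De.
have tX : t <= n.+1 ^ (J.+1 * b').
  rewrite expnM; set X := n.+1 ^ J.+1 in tle *.
  have JX : J <= X by apply: leq_trans (ltnW (ltn_expl J.+1 _)); rewrite ?ltnS.
  have X1 : 1 < X by apply: leq_trans (ltn_expl J.+1 _); rewrite ?ltnS.
  apply: leq_trans (Hb' _ X1); apply: leq_trans tle _.
  by rewrite addn1; move: (X ^ b) => Y; nia.
apply: leq_trans tX _.
have [n1|n1] := leqP n 1.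
  have {}n1 : n = 1 by lia.
  have := has_multipacking_card mJ; rewrite card_ord n1 exp1n muln1 => J2.
  by apply: leq_trans (leq_addr _ _); rewrite leq_pexp2l // leq_mul2r; lia.
have d0 : 0 < d by apply: diameter_gt0 De; rewrite card_ord.
have Jd : J.+1 <= 3 * d.
  by have := has_multipacking_diameter De mJ; rewrite (maxn_idPl d0); lia.
have c0 : 0 < c by rewrite addn_gt0 expn_gt0.
apply: (@leq_trans (n ^ (c * d))); last exact: leq_pmull.
apply: (@leq_trans ((n ^ 2) ^ (J.+1 * b'))).
  have : n.+1 <= n ^ 2 by rewrite -mulnn; nia.
  exact: leq_expnl.
rewrite -expnM leq_pexp2l //.
by apply: (@leq_trans (6 * b' * d)); [nia|rewrite leq_mul2r leq_addl orbT].
Qed.
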